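(* Let $v_0>0$. For ${\rm M}\ge0$ define on ${\mathbb Q}_{\rm M}={\mathbb Q}^\uparrow_{\rm M}\cup{\mathbb Q}^\downarrow_{\rm M}$ the functions $$\tau_{\rm M}(d,f):=\begin{cases}\displaystyle 2\sqrt{\frac{2d}{v_0}}\int_{-1}^{1}\frac{dx}{\sqrt{(1-x^2)\big(d^2x^2-4d{\rm M}x+4f-d^2\big)}} & (d,f)\in{\mathbb Q}^\uparrow_{\rm M},\\[3mm] \displaystyle 2\sqrt{\frac{2d}{v_0}}\int_{-1}^{x_{\rm M}(d,f)}\frac{dx}{\sqrt{(1-x^2)\big(d^2x^2-4d{\rm M}x+4f-d^2\big)}} & (d,f)\in{\mathbb Q}^\downarrow_{\rm M},\end{cases}$$ and $${\rm t}_{\rm M}(d,f):=\begin{cases}\displaystyle 2\sqrt{\frac{2d}{v_0}}\int_{0}^{z_{\rm M}(d,f)}\frac{dz}{\sqrt{z(2-z)\big({\rm M}^2z^2-2fz+d^2\big)}} & (d,f)\in{\mathbb Q}^\uparrow_{\rm M},\\[3mm] \displaystyle \sqrt{\frac{2d}{v_0}}\int_{0}^{2}\frac{dz}{\sqrt{z(2-z)\big({\rm M}^2z^2-2fz+d^2\big)}} & (d,f)\in{\mathbb Q}^\downarrow_{\rm M},\end{cases}$$ where $x_{\rm M}(d,f)$ is the minimum root of $d^2x^2-4d{\rm M}x+4f-d^2$ and $z_{\rm M}(d,f)$ is the minimum root of ${\rm M}^2z^2-2fz+d^2$. Then ${\rm t}_{\rm M}$ is well-defined on ${\mathbb Q}_{\rm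 M}$ and $${\rm t}_{\rm M}(d,f)=\tau_{\rm M}(d,f)\qquad\forall\ {\rm M}\ge0,\ \forall\ (d,f)\in{\mathbb Q}_{\rm M}.$$
   Context: For ${\rm M}\ge0$ and $d>0$ put $$f^-_{\rm M}(d)=-{\rm M}d,\qquad f^{\rm s}_{\rm M}(d)=\begin{cases}{\rm M}d&0<d\le2{\rm M}\\ {\rm M}^2+\frac{d^2}{4}&d>2{\rm M}.\end{cases}$$ Domains: $${\mathbb Q}_{\rm M}=\{(d,f)\in{\mathbb R}^2:\ d>0,\ f>f^-_{\rm M}(d),\ f\ne f^{\rm s}_{\rm M}(d)\},$$ ${\mathbb Q}^\uparrow_{\rm M}=\{(d,f)\in{\mathbb Q}_{\rm M}: f>f^{\rm s}_{\rm M}(d)\}$, ${\mathbb Q}^\downarrow_{\rm M}=\{(d,f)\in{\mathbb Q}_{\rm M}: f<f^{\rm s}_{\rm M}(d)\}$. On ${\mathbb Q}^\downarrow_{\rm M}$ the root $x_{\rm M}(d,f)$ is real, and on ${\mathbb Q}^\uparrow_{\rm M}$ the root $z_{\rm M}(d,f)$ is real (for ${\rm M}=0$, $z_0(d,f)=d^2/(2f)$). ''Well-defined'' means that the expression under the square root is positive in the open interval of integration and the integral converges. *)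

(* Defs.v *)
From Stdlib Require Import Reals.
From Coquelicot Require Import Coquelicot.
Open Scope R_scope.

Definition f_minus (M d : R) : R := - (M * d).

Definition f_s (M d : R) : R :=
  if Rle_dec d (2 * M) then M * d else M ^ 2 + d ^ 2 / 4.

Definition Q (M d f : R) : Prop := 0 < d /\ f_minus M d < f /\ f <> f_s M d.
Definition Q_up (M d f : R) : Prop := Q M d f /\ f_s M d < f.
Definition Q_down (M d f : R) : Prop := Q M d f /\ f < f_s M d.

Definition x_poly (M d f x : R) : R := d ^ 2 * x ^ 2 - 4 * d * M * x + 4 * f - d ^ 2.
Definition z_poly (M d f z : R) : R := M ^ 2 * z ^ 2 - 2 * f * z + d ^ 2.

Definition is_min_root (p : R -> R) (r : R) : Prop :=
  p r = 0 /\ forall s : R, p s = 0 -> r <= s.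

(* For M = 0 the polynomial z_poly is affine in z and z_root 0 d f = d^2 / (2 f). *)
Definition x_root (M d f : R) : R := iota (is_min_root (x_poly M d f)).
Definition z_root (M d f : R) : R := iota (is_min_root (z_poly M d f)).

Definition x_radicand (M d f x : R) : R := (1 - x ^ 2) * x_poly M d f x.
Definition z_radicand (M d f z : R) : R := z * (2 - z) * z_poly M d f z.

(* The improper Riemann integral of 1 / sqrt g over the open interval (a, b),
   both endpoints being approached independently from inside. *)
Definition int_inv_sqrt (g : R -> R) (a b : R) : R :=
  RInt_gen (fun x => / sqrt (g x)) (at_right a) (at_left b).

Definition int_inv_sqrt_well_defined (g : R -> R) (a b : R) : Prop :=
  a < b /\
  (forall x : R, a < x < b -> 0 < g x) /\
  ex_RInt_gen (fun x => / sqrt (g x)) (at_right a) (at_left b).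

(* tau and t are meaningful on Q M only, where the else branches are
   exactly the case f < f_s M d. *)
Definition tau (v0 M d f : R) : R :=
  if Rlt_dec (f_s M d) f
  then 2 * sqrt (2 * d / v0) * int_inv_sqrt (x_radicand M d f) (-1) 1
  else 2 * sqrt (2 * d / v0) * int_inv_sqrt (x_radicand M d f) (-1) (x_root M d f).

Definition t (v0 M d f : R) : R :=
  if Rlt_dec (f_s M d) f
  then 2 * sqrt (2 * d / v0) * int_inv_sqrt (z_radicand M d f) 0 (z_root M d f)
  else sqrt (2 * d / v0) * int_inv_sqrt (z_radicand M d f) 0 2.

(* An endpoint of integration given as a minimum root must exist: x_root and
   z_root are total and carry no information when there is no such root. *)
Definition tau_well_defined (M d f : R) : Prop :=
  (Q_up M d f -> int_inv_sqrt_well_defined (x_radicand M d f) (-1) 1) /\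
  (Q_down M d f ->
     is_min_root (x_poly M d f) (x_root M d f) /\
     int_inv_sqrt_well_defined (x_radicand M d f) (-1) (x_root M d f)).

Definition t_well_defined (M d f : R) : Prop :=
  (Q_up M d f ->
     is_min_root (z_poly M d f) (z_root M d f) /\
     int_inv_sqrt_well_defined (z_radicand M d f) 0 (z_root M d f)) /\
  (Q_down M d f -> int_inv_sqrt_well_defined (z_radicand M d f) 0 2).

(* Main.v *)
Require Import Defs.
From Stdlib Require Import Reals Lra.
From Coquelicot Require Import Coquelicot.
Open Scope R_scope.

(** Both sides are complete elliptic integrals, and the curves
    [y^2 = x_radicand x] and [y^2 = z_radicand z] are related by an isogeny of
    degree two (for generic parameters, when both are elliptic curves).  On the
    level of abscissas it is the rational function

      [z_of_x x = d^2 (1 - x^2) / (2 (f - d M x))],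

    which vanishes at [x = 1] and [x = -1], takes the value [2] exactly at the
    roots of [x_poly], and has the roots of [z_poly] as critical values.  Hence
    [z], [2 - z] and [z_poly z] pull back to [1 - x^2], [x_poly x] and a perfect
    square, up to constants and powers of [f - d M x], and the two differentials agree up to
    a factor: [dz / sqrt (z_radicand z) = +- 2 dx / sqrt (x_radicand x)], with
    the sign of the derivative of [z_of_x], that is, of [crit_poly].

    For [f > f_s M d] the polynomial [crit_poly] has one root [x0] in [(-1,1)],
    and [z_of_x] folds [(-1,1)] onto [(0, z_root]]: it increases from [0] to
    [z_root] on [(-1,x0)] and decreases back to [0] on [(x0,1)].  Each half
    contributes half of the [z]-integral, so the [x]-integral over [(-1,1)] and
    the [z]-integral are equal ([x_up_of_z_up]).

    For [f < f_s M d] the map is increasing from [(-1, x_root)] onto [(0,2)],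
    and the [x]-integral is half of the [z]-integral ([x_down_of_z_down]).  This
    explains why the factor [2] in front of the second branch of [t] is absent.

    Convergence has to be shown for the [z]-integrals only, as the change of
    variables carries it over to the [x]-integrals.  There the radicand
    vanishes simply at both endpoints, and such an integral is a proper
    integral in disguise ([ex_RInt_gen_inv_sqrt]). *)

(** * Improper integrals *)

(** Substitution in an improper integral.  The limits of [phi] along [Fa] and
    [Fb] are expressed by filters, so that [phi] may reverse the direction in
    which an endpoint is approached. *)
Lemma is_RInt_gen_comp (f phi dphi : R -> R) (Fa Fb Ga Gb : (R -> Prop) -> Prop)
    {FFa : Filter Fa} {FFb : Filter Fb} (l : R) :
  filterlim phi Fa Ga -> filterlim phi Fb Gb ->
  filter_prod Fa Fb (fun ab => forall x : R,
    Rmin (fst ab) (snd ab) <= x <= Rmax (fst ab) (snd ab) ->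
    continuous f (phi x) /\ is_derive phi x (dphi x) /\ continuous dphi x) ->
  is_RInt_gen f Ga Gb l ->
  is_RInt_gen (fun x => dphi x * f (phi x)) Fa Fb l.
Proof.
intros Ha Hb Hreg Hf P HP.
assert (Hpull : filter_prod Fa Fb
  (fun ab => exists y, is_RInt f (phi (fst ab)) (phi (snd ab)) y /\ P y)).
{ destruct (Hf P HP) as [A B HA HB HAB].
  exists (fun x => A (phi x)) (fun x => B (phi x)).
  - exact (Ha A HA).
  - exact (Hb B HB).
  - intros x y Hx Hy. exact (HAB (phi x) (phi y) Hx Hy). }
unfold filtermapi.
refine (filter_imp _ _ _ (filter_and _ _ Hreg Hpull)).
intros [u v]; cbn; intros [Hr [y [Hy Py]]].
exists y. split; [|exact Py].
rewrite <- (is_RInt_unique _ _ _ _ Hy).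
apply (is_RInt_comp f phi dphi u v).
- intros x Hx. apply (Hr x Hx).
- intros x Hx. apply (Hr x Hx).
Qed.

(** Around a point where the integrand is continuous, a limit bound may be
    exchanged for the point itself, because the piece in between vanishes. *)
Lemma is_RInt_gen_vanishing (f : R -> R) (c : R) (F : (R -> Prop) -> Prop)
    {FF : Filter F} :
  filter_le F (locally c) -> locally c (continuous f) ->
  is_RInt_gen f (at_point c) F 0.
Proof.
intros HF [eps Hc].
assert (Hint : locally c (fun x => is_RInt f c x (RInt f c x))).
{ exists eps. intros x Hx. apply (RInt_correct (V := R_CompleteNormedModule)).
  apply (ex_RInt_continuous (V := R_CompleteNormedModule)).
  intros z Hz. apply Hc.
  change (Rabs (z - c) < eps). change (Rabs (x - c) < eps) in Hx.
  revert Hz Hx. unfold Rmin, Rmax, Rabs.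
  destruct (Rle_dec c x); repeat destruct (Rcase_abs _); lra. }
intros P HP.
assert (H0 : locally c (fun x => P (RInt f c x))).
{ apply (continuous_RInt_0 f c (RInt f c) Hint).
  rewrite RInt_point. exact HP. }
exists (fun x => x = c) (fun x => is_RInt f c x (RInt f c x) /\ P (RInt f c x)).
- reflexivity.
- apply HF. apply filter_and; assumption.
- intros x y -> [Hi Hp]. exists (RInt f c y). split; assumption.
Qed.

Lemma at_right_le_locally (c : R) : filter_le (at_right c) (locally c).
Proof. apply filter_le_within. Qed.

Lemma at_left_le_locally (c : R) : filter_le (at_left c) (locally c).
Proof. apply filter_le_within. Qed.

(** Additivity over a middle bound that is only a limit: any point of the
    intersection of the two middle neighbourhoods can serve to split. *)
Lemma is_RInt_gen_trans (f : R -> R) (Fa F Fc : (R -> Prop) -> Prop)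
    {FFa : Filter Fa} {FF : ProperFilter F} {FFc : Filter Fc} (l1 l2 : R) :
  is_RInt_gen f Fa F l1 -> is_RInt_gen f F Fc l2 ->
  is_RInt_gen f Fa Fc (l1 + l2).
Proof.
intros H1 H2. apply (filterlimi_locally (U := R_UniformSpace)). intros eps.
assert (H1' := proj1 (filterlimi_locally (U := R_UniformSpace) _ _) H1 (pos_div_2 eps)).
assert (H2' := proj1 (filterlimi_locally (U := R_UniformSpace) _ _) H2 (pos_div_2 eps)).
destruct H1' as [A B HA HB HAB], H2' as [B' C HB' HC HBC].
exists A C; [exact HA | exact HC |].
intros a c Ha Hc.
destruct (filter_ex _ (filter_and _ _ HB HB')) as [b [Hb Hb']].
destruct (HAB a b Ha Hb) as [y1 [I1 B1]], (HBC b c Hb' Hc) as [y2 [I2 B2]].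
exists (y1 + y2). split.
- exact (is_RInt_Chasles (V := R_NormedModule) f a b c y1 y2 I1 I2).
- change (Rabs (y1 - l1) < eps / 2) in B1. change (Rabs (y2 - l2) < eps / 2) in B2.
  change (Rabs (y1 + y2 - (l1 + l2)) < eps).
  apply Rabs_def2 in B1. apply Rabs_def2 in B2. apply Rabs_def1; lra.
Qed.

Lemma is_RInt_gen_join (f : R -> R) (Fa Fb : (R -> Prop) -> Prop)
    {FFa : Filter Fa} {FFb : Filter Fb} (c l1 l2 : R) :
  locally c (continuous f) ->
  is_RInt_gen f Fa (at_left c) l1 -> is_RInt_gen f (at_right c) Fb l2 ->
  is_RInt_gen f Fa Fb (l1 + l2).
Proof.
intros Hc H1 H2.
assert (Hl : is_RInt_gen f (at_left c) (at_point c) (- 0))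
  by exact (is_RInt_gen_swap (V := R_NormedModule) f 0
              (is_RInt_gen_vanishing f c _ (at_left_le_locally c) Hc)).
assert (Hr := is_RInt_gen_vanishing f c _ (at_right_le_locally c) Hc).
replace (l1 + l2) with (l1 + (- 0 + (0 + l2))) by ring.
exact (is_RInt_gen_trans f _ _ _ _ _ H1
        (is_RInt_gen_trans f _ _ _ _ _ Hl
          (is_RInt_gen_trans f _ _ _ _ _ Hr H2))).
Qed.

Lemma near_endpoints (a b : R) (P : R -> Prop) :
  a < b -> (forall x, a < x < b -> P x) ->
  filter_prod (at_right a) (at_left b) (fun ab => forall x,
    Rmin (fst ab) (snd ab) <= x <= Rmax (fst ab) (snd ab) -> P x).
Proof.
intros Hab HP.
exists (fun x => a < x < b) (fun x => a < x < b).
- exists (mkposreal (b - a) ltac:(lra)). intros y Hy Hay.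
  change (Rabs (y - a) < b - a) in Hy. apply Rabs_def2 in Hy. lra.
- exists (mkposreal (b - a) ltac:(lra)). intros y Hy Hay.
  change (Rabs (y - b) < b - a) in Hy. apply Rabs_def2 in Hy. lra.
- intros u v Hu Hv x; cbn; intros Hx. apply HP.
  revert Hx. unfold Rmin, Rmax. destruct (Rle_dec u v); lra.
Qed.

(** Only the values of [f] on the segment matter, so [f] is replaced by an
    extension that is continuous, hence integrable, on the whole line. *)
Lemma ex_RInt_gen_continuous (f : R -> R) (a b : R) :
  (forall x, a <= x <= b -> continuous f x) -> a < b ->
  ex_RInt_gen f (at_right a) (at_left b).
Proof.
intros Hf Hab.
destruct (C0_extension_le f a b Hf) as [g [Hg Hgf]].
exists (0 + (RInt g a b + 0)).
apply (is_RInt_gen_ext g).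
{ refine (filter_imp _ _ _ (near_endpoints a b _ Hab (fun x Hx => Hgf x _))); [|lra].
  intros [u v] Huv x Hx. apply Huv. lra. }
assert (Hcont : forall c, locally c (continuous g)).
{ intros c. apply filter_forall. exact Hg. }
refine (is_RInt_gen_Chasles g a _ _ _ (is_RInt_gen_Chasles g b _ _ _ _)).
- replace 0 with (opp 0) by apply Ropp_0.
  refine (is_RInt_gen_swap (V := R_NormedModule) g 0 _).
  exact (is_RInt_gen_vanishing g a _ (at_right_le_locally a) (Hcont a)).
- apply is_RInt_gen_at_point. apply (RInt_correct (V := R_CompleteNormedModule)).
  apply (ex_RInt_continuous (V := R_CompleteNormedModule)). intros z _. apply Hg.
- exact (is_RInt_gen_vanishing g b _ (at_left_le_locally b) (Hcont b)).
Qed.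

Lemma filterlim_within_image (phi : R -> R) (c : R) (D E : R -> Prop) :
  continuous phi c -> locally c (fun x => D x -> E (phi x)) ->
  filterlim phi (within D (locally c)) (within E (locally (phi c))).
Proof.
intros Hc HDE P HP.
assert (H := Hc _ HP).
unfold filtermap, within in *.
refine (filter_imp _ _ _ (filter_and _ _ HDE H)).
intros x [H1 H2] Hx. apply H2, H1, Hx.
Qed.

Lemma locally_of_interval (c lo hi : R) (P : R -> Prop) :
  lo < c < hi -> (forall x, lo < x < hi -> P x) -> locally c P.
Proof.
intros Hc HP.
apply (locally_interval P c lo hi); [apply Hc | apply Hc |].
intros y H1 H2. apply HP. split; assumption.
Qed.

Lemma continuous_inv_sqrt (g : R -> R) (x : R) :
  continuous g x -> 0 < g x -> continuous (fun y => / sqrt (g y)) x.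
Proof.
intros Hg Hpos. apply (continuous_comp (fun y => sqrt (g y)) Rinv).
- apply (continuous_comp g sqrt); [exact Hg | apply continuous_sqrt].
- apply continuous_Rinv. apply Rgt_not_eq, sqrt_lt_R0, Hpos.
Qed.

(** A simple zero of the radicand at each endpoint is removed by the
    substitution [u = sqrt (x - a) - sqrt (b - x)].  With
    [s = sqrt (x - a) + sqrt (b - x)] one has [s^2 + u^2 = 2 (b - a)] and
    [u s = 2 x - a - b], so [x] and [s] are continuous functions of [u], and
    [dx / sqrt ((x - a) (b - x)) = 2 du / s], where [s >= sqrt (b - a)]. *)
Lemma ex_RInt_gen_inv_sqrt (g h : R -> R) (a b : R) :
  a < b ->
  (forall x, continuous h x) ->
  (forall x, a <= x <= b -> 0 < h x) ->
  (forall x, a < x < b -> g x = (x - a) * (b - x) * h x) ->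
  ex_RInt_gen (fun x => / sqrt (g x)) (at_right a) (at_left b).
Proof.
intros Hab Hh Hpos Hg.
set (L := b - a). assert (HL : 0 < L) by (unfold L; lra).
set (s := fun u => sqrt (2 * L - u ^ 2)).
set (xi := fun u => (a + b + u * s u) / 2).
set (F := fun u => 2 / s u * / sqrt (h (xi u))).
set (phi := fun x => sqrt (x - a) - sqrt (b - x)).
set (dphi := fun x => / (2 * sqrt (x - a)) + / (2 * sqrt (b - x))).
assert (HsL : 0 < sqrt L) by (apply sqrt_lt_R0; exact HL).
assert (HsL2 : sqrt L * sqrt L = L) by (apply sqrt_sqrt; lra).
assert (Hs_cont : forall u, continuous s u).
{ intros u. apply (continuous_comp (fun u => 2 * L - u ^ 2) sqrt); [|apply continuous_sqrt].
  apply (ex_derive_continuous (V := R_NormedModule)). auto_derive. exact I. }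
assert (Hxi_cont : forall u, continuous xi u).
{ intros u. unfold xi, Rdiv.
  apply (continuous_mult (K := R_AbsRing)); [|apply continuous_const].
  apply (continuous_plus (V := R_NormedModule)); [apply continuous_const|].
  apply (continuous_mult (K := R_AbsRing)); [apply continuous_id | apply Hs_cont]. }
assert (Hs2 : forall u, - sqrt L <= u <= sqrt L -> s u * s u = 2 * L - u ^ 2 /\ 0 < s u).
{ intros u Hu. assert (u ^ 2 <= L) by nra.
  split; [apply sqrt_sqrt; lra | apply sqrt_lt_R0; lra]. }
assert (Hxi : forall u, - sqrt L <= u <= sqrt L -> a <= xi u <= b).
{ intros u Hu. destruct (Hs2 u Hu) as [E P].
  assert (Hus : (u * s u) * (u * s u) <= L * L)
    by (replace ((u * s u) * (u * s u)) with (u ^ 2 * (s u * s u)) by ring;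
        rewrite E; generalize (pow2_ge_0 (u ^ 2 - L)); nra).
  assert (- L <= u * s u <= L) by (split; nra).
  unfold xi, L in *. lra. }
assert (HF : ex_RInt_gen F (at_right (- sqrt L)) (at_left (sqrt L))).
{ apply ex_RInt_gen_continuous; [|lra]. intros u Hu.
  destruct (Hs2 u Hu) as [_ P].
  apply (continuous_mult (K := R_AbsRing)).
  - apply (continuous_mult (K := R_AbsRing)); [apply continuous_const|].
    apply (continuous_comp s Rinv); [apply Hs_cont|].
    apply continuous_Rinv, Rgt_not_eq, P.
  - apply (continuous_inv_sqrt (fun u => h (xi u))).
    + apply (continuous_comp xi h); [apply Hxi_cont | apply Hh].
    + apply Hpos, Hxi, Hu. }
destruct HF as [l Hl]. exists l.
assert (Hphi_cont : forall x, continuous phi x).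
{ intros x. apply (continuous_minus (V := R_NormedModule)).
  - apply (continuous_comp (fun x => x - a) sqrt); [|apply continuous_sqrt].
    apply (ex_derive_continuous (V := R_NormedModule)). auto_derive. exact I.
  - apply (continuous_comp (fun x => b - x) sqrt); [|apply continuous_sqrt].
    apply (ex_derive_continuous (V := R_NormedModule)). auto_derive. exact I. }
assert (Hpa : phi a = - sqrt L)
  by (unfold phi; rewrite (Rminus_diag_eq a a), sqrt_0 by reflexivity; fold L; ring).
assert (Hpb : phi b = sqrt L)
  by (unfold phi; rewrite (Rminus_diag_eq b b), sqrt_0 by reflexivity; fold L; ring).
assert (Hin : forall x, a < x < b ->
  exists p q, p = sqrt (x - a) /\ q = sqrt (b - x) /\
    0 < p /\ 0 < q /\ p * p = x - a /\ q * q = b - x /\ s (phi x) = p + q).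
{ intros x Hx. exists (sqrt (x - a)), (sqrt (b - x)).
  assert (Hp : 0 < sqrt (x - a)) by (apply sqrt_lt_R0; lra).
  assert (Hq : 0 < sqrt (b - x)) by (apply sqrt_lt_R0; lra).
  assert (Hpp : sqrt (x - a) * sqrt (x - a) = x - a) by (apply sqrt_sqrt; lra).
  assert (Hqq : sqrt (b - x) * sqrt (b - x) = b - x) by (apply sqrt_sqrt; lra).
  repeat split; try assumption.
  unfold s, phi. set (p := sqrt (x - a)) in *. set (q := sqrt (b - x)) in *.
  replace (2 * L - (p - q) ^ 2) with ((p + q) * (p + q)) by (unfold L; nra).
  apply sqrt_square. lra. }
assert (Hran : forall x, a < x < b -> - sqrt L < phi x < sqrt L).
{ intros x Hx. destruct (Hin x Hx) as (p & q & Ep & Eq & Hp & Hq & Hpp & Hqq & _).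
  unfold phi. rewrite <- Ep, <- Eq.
  assert (sqrt L * sqrt L = p * p + q * q) by (rewrite HsL2; unfold L; lra).
  split; nra. }
assert (Hxiphi : forall x, a < x < b -> xi (phi x) = x).
{ intros x Hx. destruct (Hin x Hx) as (p & q & Ep & Eq & Hp & Hq & Hpp & Hqq & Es).
  unfold xi. rewrite Es. unfold phi. rewrite <- Ep, <- Eq.
  replace ((p - q) * (p + q)) with (p * p - q * q) by ring. lra. }
apply (is_RInt_gen_ext (fun x => dphi x * F (phi x))).
{ assert (H : forall x, a < x < b -> dphi x * F (phi x) = / sqrt (g x)).
  { intros x Hx. unfold F. rewrite (Hxiphi x Hx), (Hg x Hx).
    assert (Hhx : 0 < h x) by (apply Hpos; lra).
    rewrite sqrt_mult, sqrt_mult; [|lra|lra|apply Rmult_le_pos; lra|lra].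
    destruct (Hin x Hx) as (p & q & Ep & Eq & Hp & Hq & _ & _ & Es).
    unfold dphi. rewrite Es, <- Ep, <- Eq.
    field. repeat split; try lra. apply Rgt_not_eq, sqrt_lt_R0, Hhx. }
  refine (filter_imp _ _ _ (near_endpoints a b _ Hab H)).
  intros [u v] Huv x Hx. apply Huv. lra. }
apply (is_RInt_gen_comp F phi dphi _ _ (at_right (- sqrt L)) (at_left (sqrt L))); [| | |exact Hl].
- rewrite <- Hpa. apply filterlim_within_image; [apply Hphi_cont|].
  apply (locally_of_interval a (a - 1) b); [lra|]. intros x Hx Hax.
  rewrite Hpa. apply Hran. lra.
- rewrite <- Hpb. apply filterlim_within_image; [apply Hphi_cont|].
  apply (locally_of_interval b a (b + 1)); [lra|]. intros x Hx Hax.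
  rewrite Hpb. apply Hran. lra.
- apply near_endpoints; [exact Hab|]. intros x Hx.
  assert (Hr := Hran x Hx). destruct (Hs2 (phi x) ltac:(lra)) as [_ P].
  split; [|split].
  + apply (continuous_mult (K := R_AbsRing)).
    * apply (continuous_mult (K := R_AbsRing)); [apply continuous_const|].
      apply (continuous_comp s Rinv); [apply Hs_cont|].
      apply continuous_Rinv, Rgt_not_eq, P.
    * apply (continuous_inv_sqrt (fun u => h (xi u))).
      -- apply (continuous_comp xi h); [apply Hxi_cont | apply Hh].
      -- rewrite Hxiphi by exact Hx. apply Hpos. lra.
  + unfold phi, dphi. auto_derive; [lra|].
    assert (sqrt (x - a) <> 0) by (apply Rgt_not_eq, sqrt_lt_R0; lra).
    assert (sqrt (b - x) <> 0) by (apply Rgt_not_eq, sqrt_lt_R0; lra).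
    replace (x + - a) with (x - a) by ring. replace (b + - x) with (b - x) by ring.
    field. split; assumption.
  + unfold dphi. apply (ex_derive_continuous (V := R_NormedModule)).
    assert (0 < sqrt (x - a)) by (apply sqrt_lt_R0; lra).
    assert (0 < sqrt (b - x)) by (apply sqrt_lt_R0; lra).
    auto_derive. replace (x + - a) with (x - a) by ring.
    replace (b + - x) with (b - x) by ring. repeat split; lra.
Qed.

(** * The correspondence between the two integrands *)

Definition z_of_x (M d f x : R) : R := d ^ 2 * (1 - x ^ 2) / (2 * (f - d * M * x)).

(** The numerator of the derivative of [z_of_x], up to the factor [d^2 / 2]. *)
Definition crit_poly (M d f x : R) : R := d * M * x ^ 2 - 2 * f * x + d * M.

(** The squared factor is half of the derivative of [z_of_x], which is the
    equality of the two differentials up to the factor [2]. *)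
Lemma z_radicand_z_of_x (M d f x : R) : f - d * M * x <> 0 ->
  z_radicand M d f (z_of_x M d f x) =
  (d ^ 2 * crit_poly M d f x / (4 * (f - d * M * x) ^ 2)) ^ 2 * x_radicand M d f x.
Proof.
intros HD. unfold z_radicand, z_poly, z_of_x, crit_poly, x_radicand, x_poly.
field. exact HD.
Qed.

Lemma is_derive_z_of_x (M d f x : R) : f - d * M * x <> 0 ->
  is_derive (z_of_x M d f) x
    (d ^ 2 * crit_poly M d f x / (2 * (f - d * M * x) ^ 2)).
Proof.
intros HD. unfold z_of_x, crit_poly. auto_derive.
- change (2 * (f - d * M * x) <> 0). apply Rmult_integral_contrapositive_currified; lra.
- field. exact HD.
Qed.

Lemma continuous_z_of_x (M d f x : R) :
  f - d * M * x <> 0 -> continuous (z_of_x M d f) x.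
Proof.
intros HD. apply (ex_derive_continuous (V := R_NormedModule)).
eexists. exact (is_derive_z_of_x M d f x HD).
Qed.

(** Transport of the [z]-integral through a branch on which [z_of_x] is
    monotone, increasing for [eps = 1] and decreasing for [eps = -1].  The sets
    [Ea] and [Eb] record from which side the branch reaches its end values. *)
Lemma is_RInt_gen_pullback (M d f a b eps I : R) (Ea Eb : R -> Prop) :
  0 < d -> a < b -> (eps = 1 \/ eps = - 1) ->
  (forall x, a <= x <= b -> 0 < f - d * M * x) ->
  (forall x, a < x < b -> 0 < x_radicand M d f x /\ 0 < eps * crit_poly M d f x /\
     Ea (z_of_x M d f x) /\ Eb (z_of_x M d f x)) ->
  is_RInt_gen (fun z => / sqrt (z_radicand M d f z))
    (within Ea (locally (z_of_x M d f a))) (within Eb (locally (z_of_x M d f b))) I ->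
  is_RInt_gen (fun x => / sqrt (x_radicand M d f x)) (at_right a) (at_left b)
    (eps / 2 * I).
Proof.
intros Hd Hab Heps HD Hin HI.
set (dphi := fun x => d ^ 2 * crit_poly M d f x / (2 * (f - d * M * x) ^ 2)).
apply (is_RInt_gen_ext (fun x => scal (eps / 2)
  (dphi x * / sqrt (z_radicand M d f (z_of_x M d f x))))).
{ assert (H : forall x, a < x < b ->
    eps / 2 * (dphi x * / sqrt (z_radicand M d f (z_of_x M d f x))) =
    / sqrt (x_radicand M d f x)).
  { intros x Hx. assert (HDx := HD x ltac:(lra)).
    destruct (Hin x Hx) as (HP & Hr & _).
    rewrite z_radicand_z_of_x by lra. unfold dphi.
    set (D := f - d * M * x) in *. set (r := crit_poly M d f x) in *.
    replace (d ^ 2 * r / (4 * D ^ 2)) with (eps * (d ^ 2 * (eps * r) / (4 * D ^ 2)))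
      by (destruct Heps as [-> | ->]; field; lra).
    assert (Hk : 0 < d ^ 2 * (eps * r) / (4 * D ^ 2)).
    { apply Rdiv_lt_0_compat; [apply Rmult_lt_0_compat; nra | nra]. }
    replace ((eps * (d ^ 2 * (eps * r) / (4 * D ^ 2))) ^ 2)
      with ((d ^ 2 * (eps * r) / (4 * D ^ 2)) ^ 2)
      by (destruct Heps as [-> | ->]; ring).
    rewrite sqrt_mult, sqrt_pow2 by (try apply pow2_ge_0; lra).
    assert (HS := sqrt_lt_R0 _ HP).
    assert (r <> 0) by (intros E; rewrite E in Hr; lra).
    destruct Heps as [-> | ->]; field; repeat split; lra. }
  refine (filter_imp _ _ _ (near_endpoints a b _ Hab H)).
  intros [u v] Huv x Hx. apply (Huv x). lra. }
apply (is_RInt_gen_scal (V := R_NormedModule)).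
refine (is_RInt_gen_comp (fun z => / sqrt (z_radicand M d f z)) (z_of_x M d f)
  dphi _ _ _ _ I _ _ _ HI).
- apply filterlim_within_image.
  + apply continuous_z_of_x. assert (H := HD a). lra.
  + apply (locally_of_interval a (a - 1) b); [lra|]. intros x Hx Hax.
    apply Hin. lra.
- apply filterlim_within_image.
  + apply continuous_z_of_x. assert (H := HD b). lra.
  + apply (locally_of_interval b a (b + 1)); [lra|]. intros x Hx Hax.
    apply Hin. lra.
- apply near_endpoints; [exact Hab|]. intros x Hx.
  assert (HDx := HD x ltac:(lra)). destruct (Hin x Hx) as (HP & Hr & _).
  split; [|split].
  + apply continuous_inv_sqrt.
    * apply (ex_derive_continuous (V := R_NormedModule)).
      unfold z_radicand, z_poly. auto_derive. exact Logic.I.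
    * rewrite z_radicand_z_of_x by lra. apply Rmult_lt_0_compat; [|exact HP].
      apply pow2_gt_0. apply Rmult_integral_contrapositive_currified.
      -- apply Rmult_integral_contrapositive_currified; [apply pow_nonzero; lra|].
         intros E. rewrite E in Hr. lra.
      -- apply Rinv_neq_0_compat. nra.
  + apply is_derive_z_of_x. lra.
  + apply (ex_derive_continuous (V := R_NormedModule)).
    unfold dphi, crit_poly. auto_derive.
    change (2 * ((f - d * M * x) * ((f - d * M * x) * 1)) <> 0). nra.
Qed.

(** * Thresholds and minimum roots *)

Lemma iota_is_min_root (p : R -> R) (r : R) :
  is_min_root p r -> iota (is_min_root p) = r.
Proof.
intros [Hr Hmin].
apply (iota_unique (V := R_CompleteNormedModule) (is_min_root p) r); [|split; assumption].
intros y [Hy Hymin]. apply Rle_antisym; [apply Hymin, Hr | apply Hmin, Hy].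
Qed.

Lemma f_s_ge (M d : R) : d * M <= f_s M d /\ (2 * M < d -> f_s M d = M ^ 2 + d ^ 2 / 4).
Proof.
unfold f_s. destruct (Rle_dec d (2 * M)) as [H | H].
- split; [lra | intros; lra].
- split; [|reflexivity]. assert (0 <= (d / 2 - M) ^ 2) by apply pow2_ge_0. nra.
Qed.

Lemma f_s_small (M d : R) : d <= 2 * M -> f_s M d = d * M.
Proof. intros H. unfold f_s. destruct (Rle_dec d (2 * M)); lra. Qed.

(** * The region above the threshold *)

(** Besides describing the roots of [z_poly], this is the value of [f - d M x]
    at the critical point of [z_of_x] in [(-1,1)]. *)
Definition z_disc (M d f : R) : R := sqrt (f ^ 2 - (d * M) ^ 2).

(** The last inequality says that the minimum root of [z_poly] is below [2]. *)
Lemma z_disc_bounds (M d f : R) : 0 <= M -> 0 < d -> f_s M d < f ->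
  d * M < f /\ 0 < z_disc M d f /\
  z_disc M d f * z_disc M d f = f ^ 2 - (d * M) ^ 2 /\
  d ^ 2 < 2 * (f + z_disc M d f).
Proof.
intros HM Hd Hf. destruct (f_s_ge M d) as [Hge Hbig].
assert (HfM : d * M < f) by lra.
assert (HdM : 0 <= d * M) by nra.
assert (Hpos : 0 < f ^ 2 - (d * M) ^ 2) by nra.
unfold z_disc. set (s := sqrt _).
assert (Hs : 0 < s) by (apply sqrt_lt_R0; exact Hpos).
assert (Hss : s * s = f ^ 2 - (d * M) ^ 2) by (apply sqrt_sqrt; lra).
repeat split; try assumption.
destruct (Rle_or_lt d (2 * M)) as [H | H].
- nra.
- rewrite (Hbig H) in Hf. apply Rnot_le_lt. intros Hle.
  assert (0 < d ^ 2 / 2 - f) by nra.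
  assert (Hs' : s * s <= (d ^ 2 / 2 - f) * (d ^ 2 / 2 - f)) by (apply Rmult_le_compat; lra).
  assert (d ^ 2 * (M ^ 2 + d ^ 2 / 4) < d ^ 2 * f) by (apply Rmult_lt_compat_l; nra).
  nra.
Qed.

(** The minimum root is written with the discriminant in the denominator, a
    form that stays valid for [M = 0], when [z_poly] has degree one and its
    cofactor [f + z_disc - M^2 z] becomes a nonzero constant. *)
Lemma z_up_well_defined (M d f : R) : 0 <= M -> 0 < d -> f_s M d < f ->
  let z1 := d ^ 2 / (f + z_disc M d f) in
  is_min_root (z_poly M d f) z1 /\
  int_inv_sqrt_well_defined (z_radicand M d f) 0 z1.
Proof.
intros HM Hd Hf. destruct (z_disc_bounds M d f HM Hd Hf) as (HfM & Hs & Hss & H2).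
set (s := z_disc M d f) in *. intros z1.
assert (HdM : 0 <= d * M) by nra.
assert (Hw : 0 < f + s) by lra.
assert (Hz1 : z1 * (f + s) = d ^ 2) by (unfold z1; field; lra).
assert (HMz : M ^ 2 * z1 = f - s).
{ apply Rmult_eq_reg_r with (f + s); [|lra]. rewrite Rmult_assoc, Hz1. nra. }
assert (Hz1pos : 0 < z1) by (apply Rdiv_lt_0_compat; nra).
assert (Hz12 : z1 < 2) by nra.
assert (Hfac : forall z, z_poly M d f z = (z1 - z) * (f + s - M ^ 2 * z)).
{ intros z. unfold z_poly.
  replace ((z1 - z) * (f + s - M ^ 2 * z))
    with (z1 * (f + s) - z * (f + s) - M ^ 2 * z1 * z + M ^ 2 * z ^ 2) by ring.
  rewrite Hz1, HMz. ring. }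
assert (Hh : forall z, 0 <= z <= z1 -> 0 < (2 - z) * (f + s - M ^ 2 * z)).
{ intros z Hz. assert (M ^ 2 * z <= M ^ 2 * z1) by (apply Rmult_le_compat_l; nra).
  apply Rmult_lt_0_compat; lra. }
split; [split|split; [|split]].
- rewrite Hfac. ring.
- intros z Hz. rewrite Hfac in Hz. apply Rnot_lt_le. intros Hlt.
  assert (M ^ 2 * z <= M ^ 2 * z1) by (apply Rmult_le_compat_l; nra).
  apply Rmult_integral in Hz. lra.
- exact Hz1pos.
- intros z Hz. unfold z_radicand. rewrite Hfac.
  replace (z * (2 - z) * ((z1 - z) * (f + s - M ^ 2 * z)))
    with (z * (z1 - z) * ((2 - z) * (f + s - M ^ 2 * z))) by ring.
  apply Rmult_lt_0_compat; [nra | apply Hh; lra].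
- apply (ex_RInt_gen_inv_sqrt _ (fun z => (2 - z) * (f + s - M ^ 2 * z))).
  + exact Hz1pos.
  + intros z. apply (ex_derive_continuous (V := R_NormedModule)). auto_derive. exact I.
  + exact Hh.
  + intros z Hz. unfold z_radicand. rewrite Hfac. ring.
Qed.

Lemma x_radicand_up_pos (M d f x : R) : 0 <= M -> 0 < d -> f_s M d < f ->
  -1 < x < 1 -> 0 < x_radicand M d f x.
Proof.
intros HM Hd Hf Hx. destruct (f_s_ge M d) as [Hge Hbig].
unfold x_radicand, x_poly. apply Rmult_lt_0_compat; [nra|].
destruct (Rle_or_lt d (2 * M)) as [H | H].
- assert (0 <= d * (1 - x) * (4 * M - d - d * x))
    by (apply Rmult_le_pos; nra).
  nra.
- rewrite (Hbig H) in Hf. assert (0 <= (d * x - 2 * M) ^ 2) by apply pow2_ge_0. nra.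
Qed.

(** With [x0] the root of [crit_poly] in [(-1,1)], the identity
    [z1 - z_of_x x = d^2 (x - x0)^2 / (2 (f - d M x))] shows that [z_of_x] attains
    the minimum root [z1] of [z_poly] at [x0] and stays below it elsewhere.
    The branch right of [x0] runs from [z1] down to [0]; swapping the bounds
    there compensates the sign of the differential. *)
Lemma x_up_of_z_up (M d f I : R) : 0 <= M -> 0 < d -> f_s M d < f ->
  is_RInt_gen (fun z => / sqrt (z_radicand M d f z))
    (at_right 0) (at_left (d ^ 2 / (f + z_disc M d f))) I ->
  is_RInt_gen (fun x => / sqrt (x_radicand M d f x)) (at_right (-1)) (at_left 1) I.
Proof.
intros HM Hd Hf HI. destruct (z_disc_bounds M d f HM Hd Hf) as (HfM & Hs & Hss & _).
set (s := z_disc M d f) in *. set (z1 := d ^ 2 / (f + s)) in *.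
assert (HdM : 0 <= d * M) by nra.
set (x0 := d * M / (f + s)).
assert (Hx0 : x0 * (f + s) = d * M) by (unfold x0; field; lra).
assert (Hx0' : d * M * x0 = f - s).
{ apply Rmult_eq_reg_r with (f + s); [|lra]. rewrite Rmult_assoc, Hx0. nra. }
assert (Hx0lo : 0 <= x0) by nra.
assert (Hx0hi : x0 < 1) by nra.
assert (HD : forall x, -1 <= x <= 1 -> 0 < f - d * M * x) by (intros; nra).
assert (Hcrit : forall x, crit_poly M d f x = (x0 - x) * (f + s - d * M * x)).
{ intros x. unfold crit_poly.
  replace ((x0 - x) * (f + s - d * M * x))
    with (x0 * (f + s) - x * (f + s) - d * M * x0 * x + d * M * x ^ 2) by ring.
  rewrite Hx0, Hx0'. ring. }
assert (Hz : forall x, -1 <= x <= 1 ->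
  z1 - z_of_x M d f x = d ^ 2 * (x - x0) ^ 2 / (2 * (f - d * M * x))).
{ intros x Hx. assert (HDx := HD x Hx).
  unfold z_of_x, z1.
  replace (d ^ 2 * (x - x0) ^ 2 / (2 * (f - d * M * x)))
    with (d ^ 2 * (x ^ 2 * (f + s) - 2 * x * (x0 * (f + s)) + x0 * (x0 * (f + s)))
          / (2 * (f - d * M * x) * (f + s))) by (field; lra).
  rewrite Hx0. replace (x0 * (d * M)) with (f - s) by lra. field. lra. }
assert (Hzlt : forall x, -1 <= x <= 1 -> x <> x0 -> z_of_x M d f x < z1).
{ intros x Hx Hne. assert (E := Hz x Hx). assert (HDx := HD x Hx).
  assert (0 < d ^ 2 * (x - x0) ^ 2 / (2 * (f - d * M * x))); [|lra].
  apply Rdiv_lt_0_compat; [|lra].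
  apply Rmult_lt_0_compat; apply pow2_gt_0; lra. }
assert (Hzpos : forall x, -1 < x < 1 -> 0 < z_of_x M d f x).
{ intros x Hx. assert (HDx := HD x ltac:(lra)).
  apply Rdiv_lt_0_compat; [apply Rmult_lt_0_compat; nra | lra]. }
assert (Ezm1 : z_of_x M d f (-1) = 0)
  by (assert (H := HD (-1) ltac:(lra)); unfold z_of_x; field; lra).
assert (Ez1 : z_of_x M d f 1 = 0)
  by (assert (H := HD 1 ltac:(lra)); unfold z_of_x; field; lra).
assert (Ezx0 : z_of_x M d f x0 = z1).
{ assert (E := Hz x0 ltac:(lra)). assert (H := HD x0 ltac:(lra)).
  replace (d ^ 2 * (x0 - x0) ^ 2 / (2 * (f - d * M * x0))) with 0 in E by (field; lra).
  lra. }
assert (Hleft : is_RInt_gen (fun x => / sqrt (x_radicand M d f x))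
  (at_right (-1)) (at_left x0) (1 / 2 * I)).
{ apply (is_RInt_gen_pullback M d f (-1) x0 1 I (fun z => 0 < z) (fun z => z < z1));
    [exact Hd | lra | left; reflexivity | | |].
  - intros x Hx. apply HD. lra.
  - intros x Hx. split; [|split; [|split]].
    + apply x_radicand_up_pos; try assumption. lra.
    + rewrite Hcrit, Rmult_1_l. assert (H := HD x ltac:(lra)).
      apply Rmult_lt_0_compat; lra.
    + apply Hzpos. lra.
    + apply Hzlt; lra.
  - rewrite Ezm1, Ezx0. exact HI. }
assert (Hright : is_RInt_gen (fun x => / sqrt (x_radicand M d f x))
  (at_right x0) (at_left 1) (- 1 / 2 * (- I))).
{ apply (is_RInt_gen_pullback M d f x0 1 (- 1) (- I) (fun z => z < z1) (fun z => 0 < z));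
    [exact Hd | lra | right; reflexivity | | |].
  - intros x Hx. apply HD. lra.
  - intros x Hx. split; [|split; [|split]].
    + apply x_radicand_up_pos; try assumption. lra.
    + rewrite Hcrit. assert (H := HD x ltac:(lra)).
      replace (-1 * ((x0 - x) * (f + s - d * M * x)))
        with ((x - x0) * (f + s - d * M * x)) by ring.
      apply Rmult_lt_0_compat; lra.
    + apply Hzlt; lra.
    + apply Hzpos. lra.
  - rewrite Ez1, Ezx0.
    exact (is_RInt_gen_swap (V := R_NormedModule) _ I HI). }
replace I with (1 / 2 * I + - 1 / 2 * (- I)) by field.
apply (is_RInt_gen_join _ _ _ x0); [|exact Hleft | exact Hright].
apply (locally_of_interval x0 (-1) 1); [lra|]. intros x Hx.
apply continuous_inv_sqrt; [|apply x_radicand_up_pos; assumption].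
apply (ex_derive_continuous (V := R_NormedModule)).
unfold x_radicand, x_poly. auto_derive. exact Logic.I.
Qed.

(** * The region below the threshold *)

(** If [f < d M] the discriminant of [z_poly] is negative.  Otherwise
    [2 M < d], so that [z_poly] is nonincreasing on [[0,2]] with a positive
    value at [2]. *)
Lemma z_poly_down_pos (M d f z : R) : 0 <= M -> 0 < d -> f_minus M d < f -> f < f_s M d ->
  0 <= z <= 2 -> 0 < z_poly M d f z.
Proof.
intros HM Hd Hlo Hf Hz. unfold f_minus in Hlo. unfold z_poly.
destruct (Rlt_or_le f (d * M)) as [H | H].
- assert (HMpos : 0 < M) by nra.
  assert (0 < M ^ 2 * (M ^ 2 * z ^ 2 - 2 * f * z + d ^ 2)).
  { assert (0 <= (M ^ 2 * z - f) ^ 2) by apply pow2_ge_0.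
    assert (0 < (d * M - f) * (d * M + f)) by (apply Rmult_lt_0_compat; lra).
    nra. }
  apply Rmult_lt_reg_l with (M ^ 2); nra.
- assert (Hd2 : 2 * M < d).
  { apply Rnot_le_lt. intros Hle. rewrite (f_s_small M d Hle) in Hf. lra. }
  rewrite (proj2 (f_s_ge M d) Hd2) in Hf.
  assert (0 <= (2 - z) * (2 * f - M ^ 2 * (z + 2))).
  { apply Rmult_le_pos; [lra|]. assert (0 <= M ^ 2 * (2 - z)) by (apply Rmult_le_pos; nra). nra. }
  nra.
Qed.

Lemma z_down_well_defined (M d f : R) :
  0 <= M -> 0 < d -> f_minus M d < f -> f < f_s M d ->
  int_inv_sqrt_well_defined (z_radicand M d f) 0 2.
Proof.
intros HM Hd Hlo Hf.
assert (Hq := fun z => z_poly_down_pos M d f z HM Hd Hlo Hf).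
split; [lra | split].
- intros z Hz. unfold z_radicand. apply Rmult_lt_0_compat; [nra | apply Hq; lra].
- apply (ex_RInt_gen_inv_sqrt _ (z_poly M d f)).
  + lra.
  + intros z. apply (ex_derive_continuous (V := R_NormedModule)).
    unfold z_poly. auto_derive. exact I.
  + exact Hq.
  + intros z Hz. unfold z_radicand. ring.
Qed.

Definition x_disc (M d f : R) : R := sqrt (4 * M ^ 2 + d ^ 2 - 4 * f).

Lemma x_poly_factor (M d f x : R) : 0 <= 4 * M ^ 2 + d ^ 2 - 4 * f ->
  x_poly M d f x =
  (2 * M - x_disc M d f - d * x) * (2 * M + x_disc M d f - d * x).
Proof.
intros H. unfold x_poly.
assert (E : x_disc M d f * x_disc M d f = 4 * M ^ 2 + d ^ 2 - 4 * f)
  by (apply sqrt_sqrt; exact H).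
nra.
Qed.

Lemma x_disc_bounds (M d f : R) :
  0 <= M -> 0 < d -> f_minus M d < f -> f < f_s M d ->
  0 < 4 * M ^ 2 + d ^ 2 - 4 * f /\
  - d < 2 * M - x_disc M d f < d.
Proof.
intros HM Hd Hlo Hf. unfold f_minus in Hlo.
assert (Hpos : 0 < 4 * M ^ 2 + d ^ 2 - 4 * f).
{ destruct (Rle_or_lt d (2 * M)) as [H | H].
  - rewrite (f_s_small M d H) in Hf.
    assert (0 <= (2 * M - d) ^ 2) by apply pow2_ge_0. nra.
  - rewrite (proj2 (f_s_ge M d) H) in Hf. lra. }
split; [exact Hpos|].
assert (E : x_disc M d f * x_disc M d f = 4 * M ^ 2 + d ^ 2 - 4 * f)
  by (apply sqrt_sqrt; lra).
assert (HS : 0 < x_disc M d f) by (apply sqrt_lt_R0; exact Hpos).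
set (S := x_disc M d f) in *.
split; [nra|].
destruct (Rle_or_lt d (2 * M)) as [H | H]; [|lra].
rewrite (f_s_small M d H) in Hf. nra.
Qed.

(** If [f < d M] the discriminant of [crit_poly] is negative.  Otherwise
    [2 M < d], and eliminating [f] gives the two expressions
    [2 crit_poly x = (2 M - d x) d (1 - x^2) - x (x_poly x)
                   = (2 M - d x) (d - 2 M x) + x x_disc^2],
    whose terms are nonnegative for [x <= 0] and for [x >= 0] respectively. *)
Lemma crit_poly_down_pos (M d f x : R) :
  0 <= M -> 0 < d -> f_minus M d < f -> f < f_s M d ->
  -1 < x < 1 -> 0 < 2 * M - x_disc M d f - d * x ->
  0 < crit_poly M d f x.
Proof.
intros HM Hd Hlo Hf Hx Hr.
destruct (x_disc_bounds M d f HM Hd Hlo Hf) as [Hpos _].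
unfold f_minus in Hlo. unfold crit_poly.
assert (E : x_disc M d f * x_disc M d f = 4 * M ^ 2 + d ^ 2 - 4 * f)
  by (apply sqrt_sqrt; lra).
assert (HS : 0 < x_disc M d f) by (apply sqrt_lt_R0; exact Hpos).
set (S := x_disc M d f) in *.
destruct (Rlt_or_le f (d * M)) as [H | H].
- assert (0 < d * M) by lra.
  assert (0 < (d * M - f) * (d * M + f)) by (apply Rmult_lt_0_compat; lra).
  assert (0 <= (d * M * x - f) ^ 2) by apply pow2_ge_0.
  apply Rmult_lt_reg_l with (d * M); nra.
- assert (Hd2 : 2 * M < d).
  { apply Rnot_le_lt. intros Hle. rewrite (f_s_small M d Hle) in Hf. lra. }
  destruct (Rle_or_lt x 0) as [Hx0 | Hx0].
  + assert (0 < (2 * M - d * x) * (d * (1 - x ^ 2)))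
      by (repeat apply Rmult_lt_0_compat; nra).
    assert (0 <= - x * ((2 * M - S - d * x) * (2 * M + S - d * x))).
    { apply Rmult_le_pos; [lra | apply Rmult_le_pos; lra]. }
    nra.
  + assert (0 < (2 * M - d * x) * (d - 2 * M * x)) by (apply Rmult_lt_0_compat; nra).
    assert (0 < x * (S * S)) by (apply Rmult_lt_0_compat; nra).
    nra.
Qed.

Lemma x_down_root (M d f : R) :
  0 <= M -> 0 < d -> f_minus M d < f -> f < f_s M d ->
  let x1 := (2 * M - x_disc M d f) / d in
  is_min_root (x_poly M d f) x1 /\ -1 < x1 < 1 /\
  forall x, -1 < x < x1 -> 0 < x_radicand M d f x.
Proof.
intros HM Hd Hlo Hf.
destruct (x_disc_bounds M d f HM Hd Hlo Hf) as [Hpos Hx1].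
assert (HS : 0 < x_disc M d f) by (apply sqrt_lt_R0; exact Hpos).
assert (Hfac := fun x => x_poly_factor M d f x (Rlt_le _ _ Hpos)).
intros x1.
assert (Ex1 : d * x1 = 2 * M - x_disc M d f) by (unfold x1; field; lra).
split; [split | split].
- rewrite Hfac, Ex1. ring.
- intros x Hx. rewrite Hfac, <- Ex1 in Hx. apply Rmult_integral in Hx.
  apply Rmult_le_reg_l with d; lra.
- split; nra.
- intros x Hx. unfold x_radicand. rewrite Hfac.
  assert (d * x < d * x1) by (apply Rmult_lt_compat_l; lra).
  assert (x1 < 1) by nra.
  apply Rmult_lt_0_compat; [nra | apply Rmult_lt_0_compat; lra].
Qed.

(** The identity [4 (f - d M x) = x_poly x + d^2 (1 - x^2)] keeps the
    denominator of [z_of_x] positive, and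
    [2 - z_of_x x = x_poly x / (2 (f - d M x))] shows that [2] is reached exactly
    at the minimum root of [x_poly]. *)
Lemma x_down_of_z_down (M d f I : R) :
  0 <= M -> 0 < d -> f_minus M d < f -> f < f_s M d ->
  is_RInt_gen (fun z => / sqrt (z_radicand M d f z)) (at_right 0) (at_left 2) I ->
  is_RInt_gen (fun x => / sqrt (x_radicand M d f x))
    (at_right (-1)) (at_left ((2 * M - x_disc M d f) / d)) (1 / 2 * I).
Proof.
intros HM Hd Hlo Hf HI.
destruct (x_down_root M d f HM Hd Hlo Hf) as ([Hroot _] & Hx1 & Hrad).
destruct (x_disc_bounds M d f HM Hd Hlo Hf) as [Hpos _].
set (x1 := (2 * M - x_disc M d f) / d) in *.
assert (Ex1 : d * x1 = 2 * M - x_disc M d f) by (unfold x1; field; lra).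
assert (HD4 : forall x,
  4 * (f - d * M * x) = x_poly M d f x + d ^ 2 * (1 - x ^ 2))
  by (intros x; unfold x_poly; ring).
assert (Hp : forall x, -1 < x < x1 -> 0 < x_poly M d f x).
{ intros x Hx. assert (H := Hrad x Hx). unfold x_radicand in H.
  apply Rmult_lt_reg_l with (1 - x ^ 2); nra. }
assert (HD : forall x, -1 <= x <= x1 -> 0 < f - d * M * x).
{ intros x Hx. assert (H := HD4 x).
  destruct (Req_dec x (-1)) as [-> | Hm1].
  - unfold f_minus in Hlo. lra.
  - assert (0 < d ^ 2 * (1 - x ^ 2)) by (apply Rmult_lt_0_compat; nra).
    destruct (Req_dec x x1) as [-> | Hne]; [lra|].
    assert (H' := Hp x ltac:(lra)). lra. }
assert (H2z : forall x, -1 <= x <= x1 ->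
  2 - z_of_x M d f x = x_poly M d f x / (2 * (f - d * M * x))).
{ intros x Hx. assert (H := HD x Hx). unfold z_of_x, x_poly. field. lra. }
apply (is_RInt_gen_pullback M d f (-1) x1 1 I (fun z => 0 < z) (fun z => z < 2));
  [exact Hd | lra | left; reflexivity | exact HD | |].
- intros x Hx. assert (HDx := HD x ltac:(lra)). split; [|split; [|split]].
  + apply Hrad, Hx.
  + rewrite Rmult_1_l. apply crit_poly_down_pos; try assumption; [lra|].
    assert (d * x < d * x1) by (apply Rmult_lt_compat_l; lra). lra.
  + apply Rdiv_lt_0_compat; [apply Rmult_lt_0_compat; nra | lra].
  + assert (E := H2z x ltac:(lra)).
    assert (0 < x_poly M d f x / (2 * (f - d * M * x)));
      [apply Rdiv_lt_0_compat; [apply Hp, Hx | lra] | lra].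
- assert (E1 := H2z x1 ltac:(lra)). rewrite Hroot in E1. unfold Rdiv in E1.
  rewrite Rmult_0_l in E1.
  assert (E2 : z_of_x M d f (-1) = 0)
    by (assert (H := HD (-1) ltac:(lra)); unfold z_of_x; field; lra).
  rewrite E2. replace (z_of_x M d f x1) with 2 by lra. exact HI.
Qed.

(** * The equality of the two periods *)

Theorem proposition3p1 (v0 : R) (hv0 : 0 < v0) :
  (forall M d f : R, 0 <= M -> Q M d f -> t_well_defined M d f) /\
  (forall M d f : R, 0 <= M -> Q M d f ->
     tau_well_defined M d f /\ t v0 M d f = tau v0 M d f).
Proof.
split.
- intros M d f HM (Hd & Hlo & Hne). split.
  + intros [_ Hf]. destruct (z_up_well_defined M d f HM Hd Hf) as [Hr Hw].
    unfold z_root. rewrite (iota_is_min_root _ _ Hr). split; assumption.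
  + intros [_ Hf]. exact (z_down_well_defined M d f HM Hd Hlo Hf).
- intros M d f HM (Hd & Hlo & Hne). unfold t, tau, int_inv_sqrt.
  destruct (Rlt_dec (f_s M d) f) as [Hf | Hf].
  + destruct (z_up_well_defined M d f HM Hd Hf) as [Hr (_ & _ & [J HJ])].
    assert (HJx := x_up_of_z_up M d f J HM Hd Hf HJ).
    split; [split|].
    * intros _. split; [lra | split; [|exists J; exact HJx]].
      intros x Hx. apply x_radicand_up_pos; assumption.
    * intros [_ Hf']. lra.
    * unfold z_root. rewrite (iota_is_min_root _ _ Hr).
      rewrite (is_RInt_gen_unique _ _ HJ), (is_RInt_gen_unique _ _ HJx). reflexivity.
  + assert (Hf' : f < f_s M d) by lra.
    destruct (z_down_well_defined M d f HM Hd Hlo Hf') as (_ & _ & [J HJ]).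
    assert (HJx := x_down_of_z_down M d f J HM Hd Hlo Hf' HJ).
    destruct (x_down_root M d f HM Hd Hlo Hf') as (Hr & Hx1 & Hrad).
    unfold tau_well_defined, x_root. rewrite (iota_is_min_root _ _ Hr).
    split; [split|].
    * intros [_ Hup]. lra.
    * intros _. split; [exact Hr|]. split; [lra | split; [exact Hrad | eexists; exact HJx]].
    * rewrite (is_RInt_gen_unique _ _ HJ), (is_RInt_gen_unique _ _ HJx). field.
Qed.
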